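(* Let $P$ be a pairwise-locally strongly connected poset, and let $A$ and $B$ be antichain cutsets of $P$ with $A\neq B$. Then $A$ and $B$ are disjoint.
   Context: A maximal chain of a poset is a chain not properly contained in any other. An antichain cutset of $P$ is a set of elements meeting each maximal chain of $P$ in exactly one element. A poset $Q$ is strongly connected if for any two maximal chains $\mathbf{c},\mathbf{d}$ of $Q$ there is a finite sequence of maximal chains $\mathbf{c}=\mathbf{c}^{(0)},\dots,\mathbf{c}^{(n)}=\mathbf{d}$ in which consecutive chains have symmetric difference of cardinality two. $P$ is pairwise-locally strongly connected if for all $x,y\in P$ there is some closed interval $[a,b]=\{z: a\le z\le b\}$ of $P$ containing $x$ and $y$ which, as a poset, is strongly connected. *)

(* Defs.v *)
From mathcomp Require Import all_boot all_order.
From mathcomp Require Import interval boolp classical_sets cardinality.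

Set Implicit Arguments.
Unset Strict Implicit.
Unset Printing Implicit Defensive.

Import Order.TTheory.
Local Open Scope order_scope.
Local Open Scope classical_set_scope.
Local Open Scope card_scope.

(* A subset Q of a poset P is regarded as a poset under the induced order;
   P itself is the case Q = [set: P]. *)
Section PosetChains.
Context {d : Order.disp_t} {P : porderType d}.
Implicit Types Q C A : set P.

Definition chain_of Q C : Prop :=
  C `<=` Q /\ total_on C (fun x y : P => x <= y).

Definition maximal_chain_of Q C : Prop :=
  chain_of Q C /\ ~ (exists D : set P, chain_of Q D /\ C `<` D).

Definition antichain_cutset A : Prop :=
  forall C, maximal_chain_of [set: P] C -> exists! x : P, (A `&` C) x.

(* [c 0, ..., c n] is the sequence of maximal chains; `+` is symmetric
   difference. *)
Definition strongly_connected Q : Prop :=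
  forall C D : set P, maximal_chain_of Q C -> maximal_chain_of Q D ->
  exists (n : nat) (c : nat -> set P),
    [/\ c 0%N = C, c n = D,
        forall i : nat, (i <= n)%N -> maximal_chain_of Q (c i)
      & forall i : nat, (i < n)%N -> c i `+` c i.+1 #= `I_2].

End PosetChains.

Definition pairwise_locally_strongly_connected
    (d : Order.disp_t) (P : porderType d) : Prop :=
  forall x y : P, exists a b : P,
    [/\ `[a, b] x, `[a, b] y & strongly_connected `[a, b]].

(* Main.v *)
Require Import Defs.
From mathcomp Require Import all_boot all_order.
From mathcomp Require Import interval boolp classical_sets cardinality.

(* Suppose z lies in both cutsets and x in A.  Inside a strongly connected
   interval [a, b] containing x and z, every maximal chain meets both A and B.
   Replacing a single element of a maximal chain preserves the property of
   containing a point of A and B: if the common point is removed, then A and B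
   can only meet the new chain at the one element that was added.  So the
   property propagates from a chain through z to a chain through x, whose
   unique point of A is x, whence x lies in B. *)

Import Order.TTheory.
Local Open Scope classical_set_scope.

Section MaximalChains.
Local Open Scope order_scope.
Local Open Scope classical_set_scope.
Context {d : Order.disp_t} {P : porderType d}.
Implicit Types Q C A B : set P.

Lemma chain_of_extend Q C :
  chain_of Q C -> exists M, maximal_chain_of Q M /\ C `<=` M.
Proof.
move=> [CQ Ctot].
(* Quantifying over X `|` C makes the union of the empty family admissible
   in Zorn's lemma. *)
have [F Fsub Ftot|M [Mch Mmax]] :=
    @Zorn_bigcup P [set X | chain_of Q (X `|` C)].
  split=> [y [[X /Fsub [XQ _] Xy]|/CQ //]|]; first by apply: XQ; left.
  move=> y y' [[X FX Xy]|Cy] [[X' FX' X'y']|Cy'].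
  - have [XX'|X'X] := Ftot _ _ FX FX'.
    + by have [_] := Fsub _ FX'; apply; left=> //; exact: XX'.
    + by have [_] := Fsub _ FX; apply; left=> //; exact: X'X.
  - by have [_] := Fsub _ FX; apply; [left|right].
  - by have [_] := Fsub _ FX'; apply; [right|left].
  - exact: Ctot.
exists (M `|` C); split; last by move=> y; right.
(* A chain [D] strictly above the union of [M] and [C] absorbs [C], so it belongs to the Zorn family
   and contradicts the maximality of [M]. *)
split=> // -[D [Dch [sub nsub]]]; apply: (Mmax D).
  split=> [y My|DM]; first by apply: sub; left.
  by apply: nsub => y /DM; left.
by rewrite /= (_ : D `|` C = D) //; apply/setUidPl => y Cy; apply: sub; right.
Qed.

Lemma maximal_chain_of_mem Q C x : maximal_chain_of Q C -> Q x ->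
  (forall y, C y -> x <= y \/ y <= x) -> C x.
Proof.
move=> [[CQ Ctot] Cmax] Qx cmp; apply: contrapT => nCx; apply: Cmax.
exists (x |` C); split; last first.
  by split=> [y|/(_ x (or_introl erefl))]; [right|].
split=> [y [->|/CQ]//|y y' [->|Cy] [->|Cy']].
- by left.
- exact: cmp.
- by have [|] := cmp y Cy; [right|left].
- exact: Ctot.
Qed.

Lemma maximal_chain_of_through Q x :
  Q x -> exists C, maximal_chain_of Q C /\ C x.
Proof.
move=> Qx; have [|C [Cmax xC]] := @chain_of_extend Q [set x].
  by split=> [y -> //|y y' -> ->]; left.
by exists C; split=> //; exact: xC.
Qed.

(** Two comparable elements form a chain, which extends to a maximal chain, and that chain meets [A]
    only once. *)
Lemma antichain_cutset_eq A x y :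
  antichain_cutset A -> A x -> A y -> x <= y \/ y <= x -> x = y.
Proof.
move=> cutA Ax Ay xy; have [|M [Mmax sM]] :=
    @chain_of_extend [set: P] [set x; y].
  split=> // u v [->|->] [->|->]; [by left|exact: xy| |by left].
  by case: xy; [right|left].
have [w [_ wE]] := cutA M Mmax.
rewrite -(wE x); first by apply: wE; split=> //; apply: sM; right.
by split=> //; apply: sM; left.
Qed.

(** Extending [C] to a maximal chain [M] of [P] gives a point [u] of [A], which could a priori lie
    outside the interval. The point [x] prevents this, and maximality of [C] then puts [u] in
    [C]. *)
Lemma antichain_cutset_meets_itv A C a b x : antichain_cutset A ->
  A x -> `[a, b] x -> maximal_chain_of `[a, b] C -> exists u, A u /\ C u.
Proof.
move=> cutA Ax xab Cmax.
have := xab; rewrite /= in_itv /= => /andP[ax xb].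
have ab := le_trans ax xb.
have Cab y : C y -> a <= y <= b by move=> /Cmax.1.1; rewrite /= in_itv.
(* The endpoints are comparable with the whole interval, so the maximal chain [C] contains both. *)
have Ca : C a.
  apply: (maximal_chain_of_mem _ _ _ Cmax); first by rewrite /= in_itv /= lexx.
  by move=> y /Cab /andP[]; left.
have Cb : C b.
  apply: (maximal_chain_of_mem _ _ _ Cmax).
    by rewrite /= in_itv /= lexx andbT.
  by move=> y /Cab /andP[]; right.
have [|M [Mmax CM]] := @chain_of_extend [set: P] C.
  by split=> //; exact: Cmax.1.2.
have [u [[Au Mu] _]] := cutA M Mmax.
have Mtot := Mmax.1.2.
exists u; split=> //; apply: (maximal_chain_of_mem _ _ _ Cmax); last first.
  by move=> y /CM My; exact: Mtot.
(* If [u <= a] or [b <= u], then [u] is comparable with [x] through that endpoint; both lie in [A],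
   so [u = x], which is in the interval. *)
have [ua|au] := Mtot _ _ Mu (CM _ Ca).
  by rewrite (antichain_cutset_eq A u x) //; left; exact: le_trans ua ax.
have [ub|bu] := Mtot _ _ Mu (CM _ Cb); first by rewrite /= in_itv /= au ub.
by rewrite (antichain_cutset_eq A u x) //; right; exact: le_trans xb bu.
Qed.

End MaximalChains.

Lemma card_eq2_eq {T : Type} {S : set T} {u v w : T} : (S #= `I_2)%card ->
  S u -> S v -> S w -> u <> w -> v <> w -> u = v.
Proof.
move=> /card_set_bijP[f [fS finj _]] Su Sv Sw uw vw.
have fuw : f u <> f w by move=> /finj; rewrite !inE => /(_ Su Sw).
have fvw : f v <> f w by move=> /finj; rewrite !inE => /(_ Sv Sw).
apply: finj; rewrite ?inE //.
move: (fS u Su) (fS v Sv) (fS w Sw) fuw fvw => /=.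
by case: (f u) (f v) (f w) => [|[|?]] [|[|?]] [|[|?]].
Qed.

Lemma antichain_cutset_common_step {d : Order.disp_t} {P : porderType d}
    {A B C D : set P} : antichain_cutset A -> antichain_cutset B ->
  total_on C (fun x y : P => x <= y)%O -> (C `+` D #= `I_2)%card ->
  (exists u, A u /\ D u) -> (exists v, B v /\ D v) ->
  (exists w, [/\ A w, B w & C w]) -> exists w, [/\ A w, B w & D w].
Proof.
move=> cutA cutB Ctot CD2 [u [Au Du]] [v [Bv Dv]] [w [Aw Bw Cw]].
have [Dw|nDw] := pselect (D w); first by exists w.
have uw : u <> w by move=> E; rewrite E in Du.
have vw : v <> w by move=> E; rewrite E in Dv.
have nCu : ~ C u.
  by move=> Cu; apply: uw; apply: (antichain_cutset_eq A) => //; exact: Ctot.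
have nCv : ~ C v.
  by move=> Cv; apply: vw; apply: (antichain_cutset_eq B) => //; exact: Ctot.
(* Here [w] is in [C] only, while [u] and [v] are in [D] only; a symmetric difference of size two
   leaves room for just one element besides [w]. *)
have uv : u = v by apply: (card_eq2_eq CD2 _ _ _ uw vw); [right|right|left].
by exists u; split=> //; rewrite uv.
Qed.

Lemma antichain_cutset_sub {d : Order.disp_t} {P : porderType d}
    {A B : set P} {z : P} : pairwise_locally_strongly_connected P ->
  antichain_cutset A -> antichain_cutset B -> A z -> B z -> A `<=` B.
Proof.
move=> conn cutA cutB Az Bz x Ax.
have [a [b [xab zab sc]]] := conn x z.
have [C [Cmax Cz]] := maximal_chain_of_through _ _ zab.
have [D [Dmax Dx]] := maximal_chain_of_through _ _ xab.
have [n [c [c0 cn cmax cstep]]] := sc C D Cmax Dmax.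
have common i : (i <= n)%N -> exists w, [/\ A w, B w & c i w].
  elim: i => [_|i IH lt_in]; first by exists z; rewrite c0.
  (* The point [z] of the interval lies in both cutsets, so it alone ensures that the next chain
     meets each of them. *)
  apply: (antichain_cutset_common_step cutA cutB _ (cstep i lt_in)).
  - exact: (cmax i (ltnW lt_in)).1.2.
  - exact: antichain_cutset_meets_itv cutA Az zab (cmax _ lt_in).
  - exact: antichain_cutset_meets_itv cutB Bz zab (cmax _ lt_in).
  - exact: IH (ltnW lt_in).
have [w [Aw Bw]] := common n (leqnn n); rewrite cn => Dw.
rewrite (antichain_cutset_eq A x w) //.
exact: Dmax.1.2.
Qed.

Theorem theorem2p1 (d : Order.disp_t) (P : porderType d) (A B : set P) :
  pairwise_locally_strongly_connected P ->
  antichain_cutset A -> antichain_cutset B -> A <> B ->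
  A `&` B = set0.
Proof.
move=> conn cutA cutB neqAB; apply/seteqP; split=> // z [Az Bz].
(* The roles of [A] and [B] are symmetric, so one common point [z] yields both inclusions. *)
apply: neqAB; apply/seteqP; split.
  exact: antichain_cutset_sub conn cutA cutB Az Bz.
exact: antichain_cutset_sub conn cutB cutA Bz Az.
Qed.
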